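(* Assume the following set-up. (1) For each $n\ge 0$ there is a countably generated measurable space $(X_n,\mathcal{E}_n)$ and a measurable mapping $i_n:(X_{n+1},\mathcal{E}_{n+1})\to(X_n,\mathcal{E}_n)$. (2) There is a measurable space $(X,\mathcal{E})$ and for each $n\ge 0$ a surjective measurable mapping $\tau_n:(X,\mathcal{E})\to(X_n,\mathcal{E}_n)$, with $i_n\circ\tau_{n+1}=\tau_n$ for all $n\ge 0$. (3) $\mathcal{E}=\sigma\bigl(\bigcup_{n\ge 0}\tau_n^{-1}(\mathcal{E}_n)\bigr)$. (4) For each sequence $\{A_n\}_{n\ge 0}$ with $A_n$ an atom of $\mathcal{E}_n$ and $A_{n+1}\subset i_n^{-1}(A_n)$ for each $n\ge 0$ there exists $x\in X$ with $\tau_n(x)\in A_n$ for all $n\ge 0$. Let $(X_n,\mathcal{E}_n)$ be a type $\mathcal{A}$ space for each $n\ge 0$ (and so $(X,\mathcal{E})$ is also a type $\mathcal{A}$ space). For each $n\ge 0$ let $\mu_n$ be a probability measure on $(X_n,\mathcal{E}_n)$ and suppose that the sequence $\{\mu_n\}_{n\ge 0}$ is consistent in that $\mu_{n+1}i_n^{-1}=\mu_n$ for each $n\ge 0$. Then there exists a unique probability measure $\mu$ on $(X,\mathcal{E})$ such that $\mu\tau_n^{-1}=\mu_n$ for all $n\ge 0$.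
   Context: $\mathbb{N}=\{0,1,2,\ldots\}$. A measurable space is a pair $(X,\mathcal{E})$ with $X$ a non-empty set and $\mathcal{E}$ a $\sigma$-algebra of subsets of $X$; it is countably generated if $\mathcal{E}=\sigma(\mathcal{S})$ for some countable $\mathcal{S}\subset\mathcal{E}$. A mapping $f:(X,\mathcal{E})\to(Y,\mathcal{F})$ is measurable if $f^{-1}(\mathcal{F})\subset\mathcal{E}$ and exactly measurable if $f^{-1}(\mathcal{F})=\mathcal{E}$, where $f^{-1}(\mathcal{F})=\{f^{-1}(F):F\in\mathcal{F}\}$. For a measure $\mu$ on $\mathcal{E}$ and measurable $f:(X,\mathcal{E})\to(Y,\mathcal{F})$, the image measure $\mu f^{-1}$ on $\mathcal{F}$ is $(\mu f^{-1})(F)=\mu(f^{-1}(F))$. For $x\in X$ let $\mathrm{a}_x$ be the intersection of all elements of $\mathcal{E}$ containing $x$; the atoms of $\mathcal{E}$ are the sets $\mathrm{a}_x$, $x\in X$. Let $\mathsf{M}=\{0,1\}^{\mathbb{N}}$ and $\mathsf{N}=\mathbb{N}^{\mathbb{N}}$, both with the product topology (discrete factors), and let $\mathcal{B}$ be the Borel $\sigma$-algebra of $\mathsf{M}$. A subset $A\subset\mathsf{M}$ is analytic if it is empty or $A=\tau(\mathsf{N})$ for some continuous $\tau:\mathsf{N}\to\mathsf{M}$; $\mathcal{A}$ is the set of analytic subsets of $\mathsf{M}$. A countably generated measurable space $(X,\mathcal{E})$ is a type $\mathcal{A}$ space if there exists an exactly measurable mapping $f:(X,\mathcal{E})\to(\mathsf{M},\mathcal{B})$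 with $f(X)\in\mathcal{A}$. *)

(* Defs.v *)
From HB Require Import structures.
From mathcomp Require Import all_boot all_order all_algebra.
From mathcomp Require Import all_classical all_reals all_analysis.

Set Implicit Arguments.
Unset Strict Implicit.
Unset Printing Implicit Defensive.

Local Open Scope classical_set_scope.

(* Carriers of measurableType are pointed, hence non-empty. *)

Definition countably_generated d (T : measurableType d) : Prop :=
  exists S : set (set T),
    [/\ countable S, S `<=` measurable & d.-measurable = <<s S >>].

Definition exactly_measurable d d' (T : measurableType d)
    (U : measurableType d') (f : T -> U) : Prop :=
  preimage_set_system [set: T] f d'.-measurable = d.-measurable.

(* The intersection ranges over all measurable sets containing x; the result
   need not be measurable. *)
Definition atom_of d (T : measurableType d) (x : T) : set T :=
  \bigcap_(E in [set E : set T | measurable E /\ E x]) E.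

Definition is_atom d (T : measurableType d) (A : set T) : Prop :=
  exists x : T, A = atom_of x.

Definition baire_space : Type := prod_topology (fun _ : nat => nat).

HB.instance Definition _ := Pointed.on baire_space.
HB.instance Definition _ := Nbhs.on baire_space.
HB.instance Definition _ := Topological.on baire_space.
HB.instance Definition _ := Uniform.on baire_space.

Definition analytic (A : set cantor_space) : Prop :=
  A = set0 \/
  exists2 t : baire_space -> cantor_space, continuous t & A = range t.

Definition type_A d (T : measurableType d) : Prop :=
  countably_generated T /\
  exists2 f : T -> g_sigma_algebraType (@open cantor_space),
    exactly_measurable f & analytic (range f).

(* Main.v *)
From HB Require Import structures.
Require Import Defs.
From mathcomp Require Import all_boot all_order all_algebra.
From mathcomp Require Import all_classical all_reals all_analysis.

Set Implicit Arguments.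
Unset Strict Implicit.
Unset Printing Implicit Defensive.

Local Open Scope classical_set_scope.
Import Order.TTheory.

(** Write [M] for the Cantor space with its Borel sets.  Exactly measurable maps
    [f n : Xn n -> M] with analytic range combine into one map [code : X -> M]
    whose [n]-th block is [f n (tau n x)]; since the [tau n] generate the
    sigma-algebra of [X], [code] is exactly measurable.

    The range of [code] is analytic.  Exactness factors [f n \o i n] through a
    Borel map of [M], namely [transition n \o f n.+1].  A point [y] whose [n]-th
    block lies in the range of [f n] and whose successive blocks are related by
    [transition n] determines atoms, each mapped by [i n] into the preceding one,
    so the hypothesis on atoms gives [x] with [code x = y].  Hence the range is a countable
    intersection of preimages of analytic sets and of Borel sets
    ([range_code]), and it remains to know that Borel sets are analytic and that
    analytic sets are stable under countable intersections and continuous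
    preimages.  These closure properties are easy for continuous images of
    closed subsets of the Baire space, and every nonempty such image is analytic
    because a nonempty closed subset is a retract ([closed_retract]).

    For the measure, the laws of the blocks 0, ..., [n] of [code] under [mun n]
    are consistent.  By compactness of [M] a finitely additive function on
    cylinders is a premeasure, so these laws have a common extension [P] on [M]
    ([kolmogorov_extension]).  The point is that [P] lives on the range of
    [code].  The law of the [n]-th block is the image of [mun n] by [f n], for
    which the analytic range of [f n] has full outer measure; an analytic set
    contains a Borel set of the same outer measure
    ([thick_inner_regular], which is Choquet's capacitability argument), so that
    law is concentrated on a Borel set inside the range of [f n].  Together with
    the relations between successive blocks this gives a Borel set [S] of
    [P]-measure 1 inside the range of [code].  A section of [code] over [S],
    constant elsewhere, is measurable for free because the sigma-algebra of [X]
    is pulled back along [code]; the required measure is the image of [P] by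
    this section.  Uniqueness holds because the sets [tau n @^-1` B] form a
    generating pi-system. *)

(** * Sequence spaces and cylinders *)

Definition agree (T : Type) (k : nat) (x y : nat -> T) :=
  forall j, (j < k)%N -> x j = y j.

Lemma agree_refl T k (x : nat -> T) : agree k x x.
Proof. by []. Qed.

Lemma agree_sym T k (x y : nat -> T) : agree k x y -> agree k y x.
Proof. by move=> xy j /xy. Qed.

Lemma agree_trans T k (x y z : nat -> T) :
  agree k x y -> agree k y z -> agree k x z.
Proof. by move=> xy yz j jk; rewrite xy// yz. Qed.

Lemma agree_le T k l (x y : nat -> T) : (k <= l)%N -> agree l x y -> agree k x y.
Proof. by move=> kl xy j jk; apply: xy; apply: leq_trans kl. Qed.

(** Membership in neighbourhoods is a statement on finite prefixes, which turns
    all the topology below into elementary arguments on sequences. *)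
Lemma nbhs_seqP (T : discreteTopologicalType)
    (x : prod_topology (fun _ : nat => T))
    (A : set (prod_topology (fun _ : nat => T))) :
  nbhs x A <-> exists k, forall y, agree k x y -> A y.
Proof.
split; last first.
  move=> [k kA]; suff : nbhs x [set y : prod_topology (fun _ : nat => T) | agree k x y].
    by apply: filterS => y /kA.
  elim: k {kA} => [|k IH]; first by apply: filterS filterT => y _ j.
  have H : nbhs x [set y : prod_topology (fun _ : nat => T) | x k = y k].
    have px : nbhs x
        ((fun y : prod_topology (fun _ : nat => T) => y k) @^-1` [set x k]).
      by apply: (@proj_continuous _ (fun _ : nat => T)); exact: discrete_set1.
    by apply: filterS px => y /= /esym.
  apply: filterS (filterI IH H) => y [/= xy xyk] j.
  by rewrite ltnS leq_eqVlt => /orP[/eqP->//|/xy].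
(* The prefixes of [x] generate a filter; it converges to [x] coordinatewise. *)
pose F : set_system (prod_topology (fun _ : nat => T)) :=
  [set B | exists k, forall y, agree k x y -> B y].
have FF : Filter F.
  split; first by exists 0%N.
    move=> P Q [k kP] [l lQ]; exists (maxn k l) => y xy.
    by split; [apply: kP|apply: lQ]; apply: agree_le xy; rewrite ?leq_maxl ?leq_maxr.
  by move=> P Q PQ [k kP]; exists k => y /kP /PQ.
suff : F --> x by apply.
apply/cvg_sup => i B [C [[D oD <-] Dx] CB].
exists i.+1 => y xy; apply: CB => /=.
by rewrite -(xy i).
Qed.

Lemma continuous_seqP (T U : discreteTopologicalType)
    (h : prod_topology (fun _ : nat => T) -> prod_topology (fun _ : nat => U)) :
  continuous h <->
  forall (x : prod_topology (fun _ : nat => T)) k, exists m,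
    forall y, agree m x y -> agree k (h x) (h y).
Proof.
split.
  move=> ch x k; have /nbhs_seqP[m mP] : nbhs x (h @^-1`
      [set z : prod_topology (fun _ : nat => U) | agree k (h x) z]).
    by apply: ch; apply/nbhs_seqP; exists k.
  by exists m.
move=> H x A /nbhs_seqP[k kA]; have [m mP] := H x k.
by apply/nbhs_seqP; exists m => y /mP /kA.
Qed.

(** The two roles of the Cantor space, topological and measurable, get separate
    names, so that the intended structure is found on each. *)
Definition borel_cantor : Type := g_sigma_algebraType (@open cantor_space).
HB.instance Definition _ := Measurable.on borel_cantor.

Definition cylinder_at k (C : set cantor_space) :=
  forall y y' : cantor_space, agree k y y' -> C y -> C y'.

(** By compactness, these are exactly the clopen sets. *)
Definition cylinder (C : set cantor_space) := exists k, cylinder_at k C.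

Lemma cylinder_at_le k l C : (k <= l)%N -> cylinder_at k C -> cylinder_at l C.
Proof. by move=> kl Ck y y' /(agree_le kl); exact: Ck. Qed.

Lemma cylinder_atC k C : cylinder_at k C -> cylinder_at k (~` C).
Proof. by move=> Ck y y' /agree_sym yy' nCy /(Ck _ _ yy'). Qed.

Lemma cylinder_atU k C D :
  cylinder_at k C -> cylinder_at k D -> cylinder_at k (C `|` D).
Proof.
by move=> Ck Dk y y' yy' [/(Ck _ _ yy')|/(Dk _ _ yy')]; [left|right].
Qed.

Lemma cylinder0 : cylinder set0.
Proof. by exists 0%N. Qed.

Lemma cylinderC C : cylinder C -> cylinder (~` C).
Proof. by move=> [k /cylinder_atC]; exists k. Qed.

Lemma cylinderU C D : cylinder C -> cylinder D -> cylinder (C `|` D).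
Proof.
move=> [k Ck] [l Dl]; exists (maxn k l); apply: cylinder_atU.
- exact: cylinder_at_le (leq_maxl _ _) Ck.
- exact: cylinder_at_le (leq_maxr _ _) Dl.
Qed.

Lemma cylinderI C D : cylinder C -> cylinder D -> cylinder (C `&` D).
Proof.
by move=> /cylinderC Cc /cylinderC Dc; rewrite -[_ `&` _]setCK setCI;
  apply/cylinderC/cylinderU.
Qed.

Lemma cylinderT : cylinder setT.
Proof. by exists 0%N. Qed.

Lemma cylinder_coord k : cylinder [set y : cantor_space | y k].
Proof. by exists k.+1 => y y' /(_ _ (ltnSn k)) /= ->. Qed.

Lemma cylinder_open C : cylinder C -> open C.
Proof.
move=> [k Ck]; rewrite openE => y Cy; apply/nbhs_seqP.
by exists k => y' yy'; exact: Ck yy' Cy.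
Qed.

(** The points whose prefix of length [k] already forces membership in [U] form
    a cylinder, so an open set is a countable union of cylinders. *)
Lemma open_bigcup_cylinder (U : set cantor_space) : open U ->
  U = \bigcup_k [set y | forall y', agree k y y' -> U y'].
Proof.
rewrite openE => oU; apply/seteqP; split => [y /oU /nbhs_seqP[k kU]|].
  by exists k.
by move=> y [k _ /(_ y)]; apply.
Qed.

Lemma borel_cantorE : @measurable _ borel_cantor = <<s cylinder >>.
Proof.
apply/seteqP; split.
  apply: smallest_sub; first exact: smallest_sigma_algebra.
  move=> U /open_bigcup_cylinder ->; apply: sigma_algebra_bigcup => k.
  apply: sub_sigma_algebra; exists k => y y' yy' yU z y'z.
  by apply: yU; exact: agree_trans y'z.
apply: smallest_sub; first exact: smallest_sigma_algebra.
by move=> C /cylinder_open oC; exact: sub_sigma_algebra.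
Qed.

Lemma measurable_cylinder C : cylinder C -> measurable (C : set borel_cantor).
Proof. by move=> /cylinder_open oC; exact: sub_sigma_algebra. Qed.

Lemma measurable_coord k : measurable [set y : borel_cantor | y k].
Proof. by apply: measurable_cylinder; exact: cylinder_coord. Qed.

(** By induction on its depth, a cylinder is a Boolean combination of coordinate
    half spaces: split on the last coordinate it depends on. *)
Lemma measurable_cantorP d (T : measurableType d) (h : T -> borel_cantor) :
  (forall k, measurable [set x | h x k]) -> measurable_fun setT h.
Proof.
move=> mh; apply: (measurability _ borel_cantorE) => _ [C [k Ck] <-].
rewrite setTI; elim: k C Ck => [|k IH] C Ck.
  have [->|/set0P[y Cy]] := eqVneq C set0; first by rewrite preimage_set0.
  rewrite (_ : C = setT) ?preimage_setT//.
  by apply/seteqP; split => // y' _; exact: Ck Cy.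
(* Freezing the last coordinate to [b] lowers the depth. *)
pose upd b (y : cantor_space) : cantor_space :=
  fun j => if j == k then b else y j.
have mupd b : measurable (h @^-1` [set y | C (upd b y)]).
  apply: IH => y y' yy'; apply: Ck => j; rewrite /upd ltnS leq_eqVlt.
  by case: eqP => //= _ /yy'.
have updE y : upd (y k) y = y.
  by apply/funext => j; rewrite /upd; case: eqP => // ->.
rewrite (_ : _ @^-1` _ = ([set x | h x k] `&` h @^-1` [set y | C (upd true y)])
    `|` (~` [set x | h x k] `&` h @^-1` [set y | C (upd false y)])).
  by apply: measurableU; apply: measurableI => //; exact: measurableC.
apply/seteqP; split => [x /= Cx|x /=].
  have := updE (h x); case: (h x k) => E; [left|right]; rewrite E//.
by have := updE (h x); case: (h x k) => E [] []// _; rewrite E.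
Qed.

(** * Limits of probability measures on the Cantor space *)

(** A copy of the Cantor space that carries the algebra of cylinders, on which
    premeasures are extended. *)
Definition cylinder_algebra : Type := cantor_space.

Fact cylinder_display : measure_display. Proof. exact: default_measure_display. Qed.

HB.instance Definition _ := Pointed.on cylinder_algebra.
HB.instance Definition _ := @isAlgebraOfSets.Build cylinder_display
  cylinder_algebra cylinder cylinder0 cylinderU cylinderC.

Lemma cylinder_cover_finite (A : set cantor_space) (F : (set cantor_space)^nat) :
  cylinder A -> (forall n, cylinder (F n)) -> A `<=` \bigcup_n F n ->
  exists n, A `<=` \big[setU/set0]_(k < n) F k.
Proof.
move=> cA cF AF.
have clA : closed A by rewrite -[A]setCK closedC; exact/cylinder_open/cylinderC.
have /(subclosed_compact clA) : compact [set: cantor_space].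
  exact: cantor_space_compact.
move=> /(_ (@subsetT _ _)); rewrite compact_cover.
move=> /(_ nat setT F (fun n _ => cylinder_open (cF n)) AF)[D _ AD].
exists (\max_(k <- finmap.enum_fset D) k).+1 => y /AD[k /= kD Fky].
rewrite -bigcup_mkord; exists k => //=.
by rewrite ltnS; exact: leq_bigmax_seq.
Qed.

(** Finite additivity passes to the limit, and compactness upgrades it to
    countable subadditivity on cylinders, whence a premeasure. *)
Lemma cantor_probability_limit (R : realType)
    (nu : nat -> probability borel_cantor R) :
  (forall C, cylinder C -> exists v, \forall n \near \oo, nu n C = v) ->
  exists P : probability borel_cantor R,
    forall C, cylinder C -> \forall n \near \oo, nu n C = P C.
Proof.
move=> nuC.
have /choice[m mP] : forall C, exists v,
    (0 <= v)%E /\ (cylinder C -> \forall n \near \oo, nu n C = v).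
  move=> C; have [/nuC[v vP]|?] := pselect (cylinder C); last by exists 0%E.
  exists v; split => //.
  by have [n <-] := filter_ex vP.
have nuE C : cylinder C -> \forall n \near \oo, nu n C = m C by case: (mP C).
pose mu : set cylinder_algebra -> \bar R := m.
have mu_ge0 C : (0 <= mu C)%E by case: (mP C).
have mu_additive : semi_additive mu.
  move=> F n cF tF cUF.
  have nuF : \forall N \near \oo, forall i : 'I_n, nu N (F i) = mu (F i).
    by apply: filter_forall => i; exact: (nuE _ (cF i)).
  have [N [NU NF]] := filter_ex (filterI (nuE _ cUF) nuF).
  rewrite /mu -NU measure_semi_additive//=.
  - by apply: eq_bigr => i _; rewrite NF.
  - by move=> k; apply: measurable_cylinder; exact: cF.
  - exact: measurable_cylinder.
pose muC := isContent.Build _ _ _ mu mu_ge0 mu_additive.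
pose mu' : {content set cylinder_algebra -> \bar R}%R := HB.pack mu muC.
have mu_sub : measurable_subset_sigma_subadditive mu'.
  move=> A F cF cA AF; have [n An] := cylinder_cover_finite cA cF AF.
  apply: (@le_trans _ _ (\sum_(k < n) mu' (F k))%E).
    by apply: content_subadditive.
  rewrite -(big_mkord xpredT (fun k => mu' (F k))).
  by apply: nneseries_lim_ge.
pose muM := Content_SigmaSubAdditive_isMeasure.Build _ _ _ mu' mu_sub.
pose mu'' : {measure set cylinder_algebra -> \bar R}%R := HB.pack mu mu' muM.
have sigE : @measurable _ borel_cantor =
    @measurable _ (g_sigma_algebraType (@measurable _ cylinder_algebra)).
  exact: borel_cantorE.
pose P0 := measure_extension mu''.
pose P : set borel_cantor -> \bar R := P0.
have PE C : cylinder C -> P C = m C.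
  by move=> cC; rewrite /P /P0 /measure_extension measurable_mu_extE.
have P_additive : semi_sigma_additive P.
  move=> F mF tF mUF.
  apply: (@measure_semi_sigma_additive _ _ _ P0) => //.
  - by move=> n; rewrite -sigE; exact: mF.
  - by rewrite -sigE.
pose PM := isMeasure.Build _ _ _ P (measure0 P0) (measure_ge0 P0) P_additive.
pose P' : {measure set borel_cantor -> \bar R}%R := HB.pack P PM.
have P1 : P' setT = 1%E.
  rewrite /= PE; last exact: cylinderT.
  by have [n <-] := filter_ex (nuE _ cylinderT); rewrite probability_setT.
pose PP := Measure_isProbability.Build _ _ _ P' P1.
exists (HB.pack_for (probability borel_cantor R) P P' PP) => C cC.
by rewrite /= PE//; exact: nuE.
Qed.

(** * Analytic sets *)

Lemma nat_pairing : exists fg : (nat * nat -> nat) * (nat -> nat * nat),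
  cancel fg.1 fg.2 /\ cancel fg.2 fg.1.
Proof.
have /card_set_bijP[f] := card_nat2.
by rewrite setTT_bijective => -[g fg gf]; exists (f, g).
Qed.

Definition pair_nat : nat * nat -> nat := (projT1 (cid nat_pairing)).1.
Definition unpair_nat : nat -> nat * nat := (projT1 (cid nat_pairing)).2.

Lemma pair_natK : cancel pair_nat unpair_nat.
Proof. by case: (projT2 (cid nat_pairing)). Qed.

Lemma unpair_natK : cancel unpair_nat pair_nat.
Proof. by case: (projT2 (cid nat_pairing)). Qed.

(** The Cantor and Baire spaces are identified with countable powers of
    themselves: a sequence is the same thing as the sequence of its blocks. *)
Definition block (T : Type) n (s : nat -> T) : nat -> T := fun j => s (pair_nat (n, j)).

Definition join_blocks (T : Type) (u : nat -> nat -> T) : nat -> T :=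
  fun k => u (unpair_nat k).1 (unpair_nat k).2.

Lemma block_join T (u : nat -> nat -> T) n : block n (join_blocks u) = u n.
Proof. by apply/funext => j; rewrite /block /join_blocks pair_natK. Qed.

Lemma block_inj T (s t : nat -> T) : (forall n, block n s = block n t) -> s = t.
Proof.
move=> st; apply/funext => k; rewrite -(unpair_natK k).
by case: (unpair_nat k) => n j; have /(congr1 (fun h => h j)) := st n.
Qed.

Lemma continuous_block (T : discreteTopologicalType) n :
  continuous (@block T n : prod_topology (fun _ : nat => T) ->
                           prod_topology (fun _ : nat => T)).
Proof.
apply/continuous_seqP => x k; exists (\max_(j < k) pair_nat (n, val j)).+1 => y xy j jk.
apply: xy; rewrite ltnS.
exact: (@leq_bigmax _ (fun j : 'I_k => pair_nat (n, val j)) (Ordinal jk)).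
Qed.

Lemma closed_seqP (T : discreteTopologicalType)
    (C : set (prod_topology (fun _ : nat => T))) :
  closed C <-> forall s, (forall k, exists2 c, C c & agree k s c) -> C s.
Proof.
split=> [cC s Cs|H].
  apply: cC => A /nbhs_seqP[k kA]; have [c Cc sc] := Cs k.
  by exists c; split => //; exact: kA.
move=> s Cs; apply: H => k.
have /Cs[c [Cc sc]] : nbhs s [set c : prod_topology (fun _ : nat => T) | agree k s c].
  by apply/nbhs_seqP; exists k.
by exists c.
Qed.

(** A nonempty closed set is a continuous retract of the Baire space: keep the
    longest prefix of [s] that extends to a point of [C], and complete it by a
    point of [C] that depends on that prefix only. *)
Lemma closed_retract (C : set baire_space) : closed C -> C !=set0 ->
  exists r : baire_space -> baire_space,
    [/\ continuous r, (forall s, C (r s)) & (forall s, C s -> r s = s)].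
Proof.
move=> /closed_seqP clC [c0 Cc0].
pose live k (s : baire_space) := exists2 c, C c & agree k s c.
pose E (s : baire_space) := [set c | C c /\ forall k, live k s -> agree k s c].
have live_le k l s : k <= l -> live l s -> live k s.
  by move=> kl [c Cc sc]; exists c => //; exact: agree_le sc.
have live_agree k s t : agree k s t -> live k s -> live k t.
  by move=> st [c Cc sc]; exists c => //; exact: agree_trans (agree_sym st) sc.
have E0 s : E s !=set0.
  have [ls|] := pselect (forall k, live k s); first by exists s; split => //; exact: clC.
  move=> /existsNP[k0 nk0].
  have ex_dead : exists k, `[< ~ live k s >] by exists k0; exact/asboolP.
  have [[|n] /asboolP nln minn] := ex_minnP ex_dead.
    by exfalso; apply: nln; exists c0.
  have [c Cc sc] : live n s.
    by apply: contrapT => /asboolP/minn; rewrite ltnn.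
  exists c; split => // k lk; apply: agree_le sc; rewrite leqNgt.
  by apply/negP => nk; apply: nln; exact: live_le lk.
(* The set [E s], hence the point chosen in it, depends on the live prefixes
   only; this is what makes [r] continuous. *)
pose r s := xget c0 (E s).
have rE s : E s (r s) by have [c Ec] := E0 s; exact: xgetI Ec.
exists r; split.
- apply/continuous_seqP => s k; exists k => t st.
  have [lk|nlk] := pselect (live k s).
    apply: agree_trans (agree_sym ((rE s).2 _ lk)) _.
    apply: (agree_trans st); apply: (rE t).2.
    exact: live_agree st lk.
  suff EE : E s = E t by rewrite /r EE.
  have live_lt j u : agree k s u -> live j u -> j <= k.
    move=> su lj; rewrite leqNgt; apply/negP => /ltnW kj; apply: nlk.
    by apply: live_agree (agree_sym su) _; exact: live_le lj.
  apply/seteqP; split=> c [Cc cP]; split=> // j lj.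
    have sj : agree j s t by apply: (agree_le _ st); exact: live_lt st lj.
    apply: agree_trans (agree_sym sj) _; apply: cP.
    by apply: live_agree (agree_sym sj) lj.
  have sj : agree j s t.
    by apply: (agree_le _ st); exact: live_lt (@agree_refl _ _ _) lj.
  apply: (agree_trans sj); apply: cP.
  by apply: live_agree sj lj.
- by move=> s; case: (rE s).
- move=> s Cs; apply/funext => j.
  by rewrite -((rE s).2 j.+1)//; exists s.
Qed.

(** This class coincides with that of analytic sets, but it treats the empty set
    uniformly and leaves room for closed constraints, which is what the closure
    properties need. *)
Definition closed_image (A : set cantor_space) :=
  exists C : set baire_space, exists u : baire_space -> cantor_space,
    [/\ closed C, continuous u & A = u @` C].

Lemma analytic_closed_image A : analytic A <-> closed_image A.
Proof.
split=> [[->|[t ct ->]]|[C [u [clC cu ->]]]].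
- exists set0, (fun=> point); split; last by rewrite image_set0.
    exact: closed0.
  exact: cst_continuous.
- by exists setT, t; split => //; exact: closedT.
have [->|/set0P C0] := eqVneq C set0; first by left; rewrite image_set0.
right; have [r [cr Cr rid]] := closed_retract clC C0.
exists (u \o r); first by move=> s; apply: continuous_comp; [exact: cr|exact: cu].
apply/seteqP; split => [_ [s Cs <-]|_ [s _ <-]].
  by exists s; rewrite //= rid.
by exists (r s).
Qed.

Lemma closed_equalizer (u v : baire_space -> cantor_space) :
  continuous u -> continuous v -> closed [set s | u s = v s].
Proof.
move=> /continuous_seqP cu /continuous_seqP cv.
apply/(@closed_seqP nat) => s H; apply/funext => j.
have [m mu] := cu s j.+1; have [n nv] := cv s j.+1.
have [c /= uvc sc] := H (maxn m n).
rewrite (mu c)//; last by apply: agree_le sc; exact: leq_maxl.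
rewrite uvc (nv c)//; by apply: agree_le sc; exact: leq_maxr.
Qed.

Lemma continuous_compT (S T U : topologicalType) (f : S -> T) (g : T -> U) :
  continuous f -> continuous g -> continuous (g \o f).
Proof. by move=> cf cg x; apply: continuous_comp; [exact: cf|exact: cg]. Qed.

(** A point of the intersection is coded by the blocks of one sequence, one for
    each set, subject to the closed condition that all of them code the same
    point. *)
Lemma closed_image_bigcap (A : (set cantor_space)^nat) :
  (forall n, closed_image (A n)) -> closed_image (\bigcap_n A n).
Proof.
move=> /choice[C /choice[u uP]].
pose v n (s : baire_space) := u n (block n s).
have cv n : continuous (v n).
  apply: (@continuous_compT _ _ _ (@block nat n : baire_space -> baire_space)).
    exact: continuous_block.
  by case: (uP n).
exists (\bigcap_n ((@block nat n : baire_space -> baire_space) @^-1` C n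
          `&` [set s | v n s = v 0 s])), (v 0); split => //.
  apply: closed_bigI => n _; apply: closedI; last exact: closed_equalizer.
  have /continuous_closedP := @continuous_block nat n; apply.
  by case: (uP n).
apply/seteqP; split => [y Ay|_ [s sP <-] n _].
  have /choice[s sP] : forall n, exists s, C n s /\ u n s = y.
    by move=> n; case: (uP n) => _ _ AE; have := Ay n I; rewrite AE => -[s Cs <-]; exists s.
  exists (join_blocks s); last by rewrite /v block_join; case: (sP 0).
  move=> n _; split; first by rewrite /= block_join; case: (sP n).
  by rewrite /= /v !block_join (sP n).2 (sP 0).2.
have [Cs vs] := sP n I; rewrite -vs.
by case: (uP n) => _ _ ->; exists (block n s).
Qed.

(** The first term of the sequence says which set of the union is meant. *)
Lemma closed_image_bigcup (A : (set cantor_space)^nat) :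
  (forall n, closed_image (A n)) -> closed_image (\bigcup_n A n).
Proof.
move=> /choice[C /choice[u uP]].
pose shift (s : baire_space) : baire_space := fun j => s j.+1.
have shift_agree k s t : agree k.+1 s t -> agree k (shift s) (shift t).
  by move=> st j jk; exact: st.
exists [set s : baire_space | C (s 0) (shift s)], (fun s => u (s 0) (shift s)).
split.
- apply/(@closed_seqP nat) => s H /=; case: (uP (s 0)) => /(@closed_seqP nat) clC _ _.
  apply: clC => k; have [c /= Cc sc] := H k.+1.
  by exists (shift c); rewrite ?sc//; exact: shift_agree.
- apply/continuous_seqP => s k.
  case: (uP (s 0)) => _ /continuous_seqP cu _.
  have [m mP] := cu (shift s) k.
  by exists m.+1 => t st; rewrite -(st 0)//; apply: mP; exact: shift_agree.
apply/seteqP; split => [y [n _]|_ [s /= Cs <-]].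
  case: (uP n) => _ _ -> [s Cs <-].
  by exists (fun j => if j is j'.+1 then s j' else n).
by exists (s 0) => //; case: (uP (s 0)) => _ _ ->; exists (shift s).
Qed.

Lemma closed_image_cylinder C : cylinder C -> closed_image C.
Proof.
move=> cC; pose u (s : baire_space) : cantor_space := fun j => s j != 0.
have cu : continuous u.
  by apply/continuous_seqP => s k; exists k => t st j jk; rewrite /u st.
exists (u @^-1` C), u; split => //.
  move/continuous_closedP: cu; apply.
  by rewrite -[C]setCK closedC; exact/cylinder_open/cylinderC.
apply/seteqP; split => [y Cy|_ [s Cs <-]//].
have uy : u (fun j => nat_of_bool (y j)) = y.
  by apply/funext => j; rewrite /u; case: (y j).
by exists (fun j => nat_of_bool (y j)); rewrite /= uy.
Qed.

Lemma closed_imageI (A B : set cantor_space) :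
  closed_image A -> closed_image B -> closed_image (A `&` B).
Proof.
move=> cA cB; rewrite -bigcap2E; apply: closed_image_bigcap => -[|[|n]] //=.
exact/closed_image_cylinder/cylinderT.
Qed.

(** The sets that belong to the class together with their complement form a
    sigma-algebra. *)
Lemma closed_image_borel (B : set borel_cantor) : measurable B -> closed_image B.
Proof.
rewrite borel_cantorE => mB.
suff : <<s cylinder >> `<=` [set B | closed_image B /\ closed_image (~` B)].
  by move=> /(_ _ mB)[].
apply: smallest_sub; last first.
  move=> C cC; split; apply: closed_image_cylinder => //; exact: cylinderC.
split.
- by split; apply: closed_image_cylinder; rewrite ?setC0; [exact: cylinder0|exact: cylinderT].
- by move=> A [cA cCA]; rewrite setTD /= setCK.
- move=> F cF; split; first by apply: closed_image_bigcup => n; case: (cF n).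
  by rewrite setC_bigcup; apply: closed_image_bigcap => n; case: (cF n).
Qed.

(** Block 0 codes a point of [A] and block 1 a point [y], under the closed
    condition that the former is [p y]. *)
Lemma closed_image_preimage (p : cantor_space -> cantor_space) A :
  continuous p -> closed_image A -> closed_image (p @^-1` A).
Proof.
move=> cp [C [u [clC cu ->]]].
pose w (s : baire_space) : cantor_space := fun j => block 1 s j != 0.
have cb n : continuous (@block nat n : baire_space -> baire_space).
  exact: continuous_block.
have cw : continuous w.
  apply/continuous_seqP => s k; have /continuous_seqP /(_ s k)[m mP] := cb 1.
  by exists m => t /mP st j jk; rewrite /w st.
exists ((@block nat 0 : baire_space -> baire_space) @^-1` C
          `&` [set s | u (block 0 s) = p (w s)]), w; split => //.
  apply: closedI.
    by have /continuous_closedP := cb 0; apply.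
  apply: closed_equalizer; last exact: continuous_compT cw cp.
  exact: continuous_compT (cb 0) cu.
apply/seteqP; split => [y [s Cs us]|_ [s [Cs us] <-]]; last by exists (block 0 s).
pose t := join_blocks (fun n => if n is 0 then s else fun j => nat_of_bool (y j)).
have wt : w t = y by apply/funext => j; rewrite /w /t block_join; case: (y j).
exists t => //; split; rewrite /= /t block_join//.
by rewrite us -/t wt.
Qed.

(** * Capacitability of analytic sets *)

(** In other words the outer measure of [A] exceeds [c], since the infimum that
    defines it is attained. *)
Definition thick (R : realType) (P : probability borel_cantor R) (c : \bar R)
    (A : set cantor_space) :=
  forall B : set borel_cantor, measurable B -> A `<=` B -> (c < P B)%E.

(** Continuity from below of the outer measure: if each [A n] had a Borel hull of
    measure at most [c], so would the increasing union, by the sets [H n]. *)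
Lemma thick_bigcup (R : realType) (P : probability borel_cantor R) c
    (A : (set cantor_space)^nat) :
  nondecreasing_seq A -> thick P c (\bigcup_n A n) -> exists n, thick P c (A n).
Proof.
move=> ndA tA; apply: contrapT => /forallNP ntA.
have /choice[B BP] : forall n, exists B : set borel_cantor,
    [/\ measurable B, A n `<=` B & (P B <= c)%E].
  move=> n; have /existsNP[B /not_implyP[mB /not_implyP[AB /negP]]] := ntA n.
  by rewrite -leNgt => PB; exists B.
pose H n := \bigcap_(m in [set m | n <= m]) B m.
have mH n : measurable (H n).
  by apply: bigcap_measurable => [|m _]; [exists n => /=|case: (BP m)].
have mUH : measurable (\bigcup_n H n) by exact: bigcupT_measurable.
have ndH : nondecreasing_seq H.
  by move=> m n mn; apply/subsetPset => y Hy k /= nk; apply: Hy; exact: leq_trans nk.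
have AH : \bigcup_n A n `<=` \bigcup_n H n.
  move=> y [n _ Ay]; exists n => // m /= nm; case: (BP m) => _ + _; apply.
  by have /subsetPset := ndA _ _ nm; apply.
have := tA _ mUH AH; rewrite ltNge => /negP; apply.
have /cvg_lim <- := nondecreasing_cvg_mu (mu := P) mH mUH ndH; last by [].
apply: lime_le.
  by apply/cvg_ex; eexists; exact: nondecreasing_cvg_mu.
apply: nearW => n /=; case: (BP n) => mB _; apply: le_trans.
by apply: le_measure; rewrite ?inE// => y; apply => /=.
Qed.

(** Bound the coordinates of the Baire space one at a time, each bound large
    enough to keep the image thick.  The surviving sequences form a compact set,
    whose image is the intersection of the cylinders [C k], each of measure more
    than [c]. *)
Lemma thick_inner_regular (R : realType) (P : probability borel_cantor R) c
    (t : baire_space -> cantor_space) :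
  continuous t -> thick P c (range t) ->
  exists K : set borel_cantor, [/\ measurable K, K `<=` range t & (c <= P K)%E].
Proof.
move=> /continuous_seqP ct tP.
pose S (l : seq nat) : set baire_space :=
  [set s | forall j, j < size l -> s j <= nth 0 l j].
have step l : exists n, thick P c (t @` S l) -> thick P c (t @` S (rcons l n)).
  have [tl|] := pselect (thick P c (t @` S l)); last by exists 0.
  suff [n nP] : exists n, thick P c (t @` S (rcons l n)) by exists n.
  apply: thick_bigcup.
    move=> m n mn; apply/subsetPset => _ [s Ss <-]; exists s => // j jl.
    apply: (leq_trans (Ss j _)); first by rewrite !size_rcons in jl *.
    by rewrite !nth_rcons; case: ifP => // _; case: ifP.
  move=> B mB tB; apply: tl => // _ [s Ss <-]; apply: tB.
  exists (s (size l)) => //; exists s => // j.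
  rewrite size_rcons ltnS leq_eqVlt nth_rcons => /orP[/eqP->|jl].
    by rewrite ltnn eqxx.
  by rewrite jl; exact: Ss.
have [g gP] := choice step.
pose L k := iter k (fun l => rcons l (g l)) [::].
have sizeL k : size (L k) = k by elim: k => //= k IH; rewrite size_rcons IH.
pose b j := nth 0 (L j.+1) j.
have nthL k j : j < k -> nth 0 (L k) j = b j.
  elim: k => // k IH; rewrite ltnS leq_eqVlt => /orP[/eqP->//|jk].
  by rewrite /= nth_rcons sizeL jk IH.
have tL k : thick P c (t @` S (L k)).
  elim: k => [|k IH]; last exact: gP.
  by move=> B mB tB; apply: tP => // _ [s _ <-]; apply: tB; exists s.
pose C k := [set y : cantor_space | exists2 s, S (L k) s & agree k (t s) y].
have cC k : cylinder (C k).
  by exists k => y y' yy' [s Ss sy]; exists s => //; exact: agree_trans yy'.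
have mC k : measurable (C k : set borel_cantor) by exact: measurable_cylinder.
have mK : measurable (\bigcap_k C k : set borel_cantor) by exact: bigcapT_measurable.
have SL k l : k <= l -> S (L l) `<=` S (L k).
  move=> kl s Ss j; rewrite sizeL => jk; rewrite nthL// -(@nthL l).
    by apply: Ss; rewrite sizeL; exact: leq_trans kl.
  exact: leq_trans kl.
exists (\bigcap_k C k); split => //.
- move=> y /= Ky.
  have /choice[s sP] : forall k, exists s, S (L k) s /\ agree k (t s) y.
    by move=> k; have [s] := Ky k I; exists s.
  have sb k j : j < k -> s k j <= b j.
    by move=> jk; rewrite -(nthL k)//; case: (sP k) => + _; apply; rewrite sizeL.
  (* The sequences [s k] need not stay in a compact set, but truncating them by
     [b] does not change their first [k] terms. *)
  pose s' k : baire_space := fun j => minn (s k j) (b j).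
  have cb : compact [set u : baire_space | forall j, u j <= b j].
    apply: (@tychonoff _ (fun _ : nat => nat) (fun j => [set n | n <= b j])) => j.
    apply: finite_compact; apply: (sub_finite_set _ (finite_II (b j).+1)).
    by move=> n /=; rewrite ltnS.
  have [|u [_ clu]] := cb (s' @ \oo) _.
    by exists 0 => // k _ j /=; exact: geq_minr.
  exists u => //; apply/funext => k; have [m mP] := ct u k.+1.
  have [||_ /= [[n kmn <-] uv]] := clu (s' @` [set n | maxn k.+1 m <= n])
    [set v | agree m u v].
  + by exists (maxn k.+1 m) => // n /= kmn; exists n.
  + by apply/(@nbhs_seqP nat); exists m.
  move: kmn; rewrite geq_max => /andP[kn mn].
  rewrite (mP (s n))//; last first.
    move=> j jm; rewrite uv// /s'; apply/minn_idPl.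
    by apply: sb; exact: leq_trans mn.
  by case: (sP n) => _; apply.
- have CP := nonincreasing_cvg_mu (mu := P) _ mC mK.
  have {}CP : P \o C @ \oo --> P (\bigcap_k C k).
    apply: CP; first by rewrite (le_lt_trans (probability_le1 P (mC 0)))// ltry.
    move=> k l kl; apply/subsetPset => y [s Ss sy]; exists s; first exact: SL Ss.
    exact: agree_le sy.
  have <- := cvg_lim _ CP; last by [].
  apply: lime_ge; first by apply/cvg_ex; eexists; exact: CP.
  apply: nearW => k /=; apply/ltW/(tL k) => //.
  by move=> _ [s Ss <-]; exists s.
Qed.

(** Exhaust by inner approximations of measure at least [1 - 1 / (n + 1)]. *)
Lemma analytic_conull_core (R : realType) (P : probability borel_cantor R)
    (A : set cantor_space) :
  analytic A ->
  (forall B : set borel_cantor, measurable B -> A `<=` B -> P B = 1%E) ->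
  exists K : set borel_cantor, [/\ measurable K, K `<=` A & P K = 1%E].
Proof.
move=> [A0 PA|[t ct ->] PA].
  have := PA set0 measurable0; rewrite A0 measure0 => /(_ (@subset_refl _ _)).
  by move=> /esym/eqP; rewrite onee_eq0.
have /choice[K KP] : forall n : nat, exists K : set borel_cantor,
    [/\ measurable K, K `<=` range t & ((1 - n.+1%:R^-1)%R%:E <= P K)%E].
  move=> n; apply: thick_inner_regular => // B mB tB; rewrite PA//.
  by rewrite lte_fin Num.Theory.ltrBlDr Num.Theory.ltrDl Num.Theory.invr_gt0.
exists (\bigcup_n K n); split.
- by apply: bigcupT_measurable => n; case: (KP n).
- by move=> y [n _ Ky]; case: (KP n) => _ + _; exact.
have mU : measurable (\bigcup_n K n).
  by apply: bigcupT_measurable => n; case: (KP n).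
apply/eqP; rewrite eq_le probability_le1//= leNgt; apply/negP.
rewrite -[P _]fineK ?fin_num_measure// lte_fin => /ltr_add_invr[k].
rewrite -Num.Theory.ltrBrDr ltNge => /negP; apply.
rewrite -lee_fin fineK ?fin_num_measure//; case: (KP k) => mK _ /le_trans; apply.
by apply: le_measure; rewrite ?inE//; exact: bigcup_sup.
Qed.

(** * Laws and exactly measurable maps on the Cantor space *)

Lemma exists_law d d' (T : measurableType d) (U : measurableType d')
    (R : realType) (P : probability T R) (h : T -> U) :
  measurable_fun setT h ->
  exists Q : probability U R, forall B, Q B = P (h @^-1` B).
Proof.
move=> mh; pose hM := isMeasurableFun.Build _ _ T U h mh.
pose h' : {mfun T >-> U} := HB.pack h hM.
by exists (distribution P h').
Qed.

Lemma probability_eq_on d (T : measurableType d) (R : realType)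
    (P : probability T R) (C A A' : set T) :
  measurable C -> P C = 1%E -> measurable A -> measurable A' ->
  A `&` C = A' `&` C -> P A = P A'.
Proof.
move=> mC PC mA mA' AA'.
have PI B : measurable B -> P B = P (B `&` C).
  move=> mB; have P0 : P (B `\` C) = 0%E.
    apply/eqP; rewrite eq_le measure_ge0 andbT.
    have <- : P (~` C) = 0%E by rewrite probability_setC// PC subee.
    by apply: le_measure; rewrite ?inE//; [exact: measurableD|exact: measurableC].
  by have := measureDI P mB mC; rewrite [X in (X + _)%E]P0 add0e.
by rewrite PI// AA' -PI.
Qed.

Lemma probability_bigcap1 d (T : measurableType d) (R : realType)
    (P : probability T R) (A : (set T)^nat) :
  (forall n, measurable (A n)) -> (forall n, P (A n) = 1%E) ->
  P (\bigcap_n A n) = 1%E.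
Proof.
move=> mA PA; have mI : measurable (\bigcap_n A n) by exact: bigcapT_measurable.
have PCA n : P (~` A n) = 0%E by rewrite probability_setC// PA subee.
have /(negligibleP P (measurableC mI)) PCI : P.-negligible (~` \bigcap_n A n).
  rewrite setC_bigcap; apply: negligible_bigcup => n; apply/negligibleP.
    exact: measurableC.
  exact: PCA.
have := probability_setC P (measurableC mI); rewrite setCK => ->.
by rewrite [X in (_ - X)%E]PCI sube0.
Qed.

Lemma measurable_equalizer d (T : measurableType d) (u v : T -> borel_cantor) :
  measurable_fun setT u -> measurable_fun setT v -> measurable [set x | u x = v x].
Proof.
move=> mu mv.
have mk (w : T -> borel_cantor) k : measurable_fun setT w -> measurable [set x | w x k].
  move=> mw; rewrite -[X in measurable X]setTI.
  by apply: (mw measurableT [set y | y k]); exact: measurable_coord.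
rewrite (_ : [set _ | _] = \bigcap_k (([set x | u x k] `&` [set x | v x k]) `|`
    (~` [set x | u x k] `&` ~` [set x | v x k]))).
  apply: bigcapT_measurable => k; apply: measurableU; apply: measurableI;
  try apply: measurableC; exact: mk.
apply/seteqP; split => [x /= uv k _ /=|x H].
  by rewrite uv; case: (v x k); [left|right].
apply/funext => k; have := H k I => /=.
by case: (u x k); case: (v x k) => -[] [].
Qed.

(** Overwriting the blocks beyond the [n]-th, instead of mapping to a smaller
    space, keeps the laws of all levels on one space. *)
Definition trunc n (y : borel_cantor) : borel_cantor :=
  fun k => if (unpair_nat k).1 <= n then y k else false.

Lemma measurable_trunc n : measurable_fun setT (trunc n).
Proof.
apply: measurable_cantorP => k; rewrite /trunc; case: (_ <= n).
  exact: measurable_coord.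
rewrite (_ : [set _ | _] = set0); first exact: measurable0.
by apply/seteqP; split.
Qed.

Lemma measurable_block n :
  measurable_fun setT (@block bool n : borel_cantor -> borel_cantor).
Proof.
by apply: measurable_cantorP => k; exact: measurable_coord.
Qed.

Lemma block_trunc m n (y : borel_cantor) :
  m <= n -> block m (trunc n y) = block m y.
Proof. by move=> mn; apply/funext => j; rewrite /block /trunc pair_natK mn. Qed.

Lemma trunc_trunc m n (y : borel_cantor) :
  m <= n -> trunc m (trunc n y) = trunc m y.
Proof.
move=> mn; apply/funext => k; rewrite /trunc; case: ifP => // km.
by rewrite (leq_trans km mn).
Qed.

Lemma cylinder_trunc C : cylinder C ->
  exists n, forall m, n <= m -> trunc m @^-1` C = C.
Proof.
move=> [k Ck]; exists (\max_(j < k) (unpair_nat j).1) => m nm.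
have tk y : agree k y (trunc m y).
  move=> j jk; rewrite /trunc (leq_trans _ nm)//.
  exact: (@leq_bigmax _ (fun j : 'I_k => (unpair_nat j).1) (Ordinal jk)).
by apply/seteqP; split => y; [exact: Ck (agree_sym (tk y))|exact: Ck (tk y)].
Qed.

Lemma cylinder_preimage_trunc n C : cylinder C -> cylinder (trunc n @^-1` C).
Proof.
move=> [k Ck]; exists k => y y' yy'; apply: Ck => j jk.
by rewrite /trunc yy'.
Qed.

(** On a given cylinder the laws [nu n] are eventually constant. *)
Lemma kolmogorov_extension (R : realType)
    (nu : nat -> probability borel_cantor R) :
  (forall m n B, m <= n -> measurable B -> nu n (trunc m @^-1` B) = nu m B) ->
  exists P : probability borel_cantor R,
    forall n B, measurable B -> P (trunc n @^-1` B) = nu n B.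
Proof.
move=> nuE.
have [|P PE] := @cantor_probability_limit R nu.
  move=> C cC; have [n tC] := cylinder_trunc cC; exists (nu n C).
  exists n => // m /= nm; rewrite -(nuE _ _ _ nm) ?tC//.
  exact: measurable_cylinder.
exists P => n; have [Q QE] := exists_law P (measurable_trunc n).
move=> B mB; rewrite -QE.
apply: (@measure_unique _ R borel_cantor cylinder (fun=> setT) borel_cantorE
  _ _ _ Q (nu n)) => //.
- exact: cylinderI.
- by move=> _; exact: cylinderT.
- by rewrite bigcup_const.
- move=> C cC; apply: (etrans (QE C)).
  have [N _ NP] := PE _ (cylinder_preimage_trunc n cC).
  rewrite -(NP (maxn n N)) /= ?leq_maxr//.
  by apply: nuE; [exact: leq_maxl|exact: measurable_cylinder].
- by move=> _; rewrite [X in (X < _)%E](probability_setT Q) ltry.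
Qed.

(** The [k]-th coordinate of [h] is the indicator of a measurable set, that is,
    of the preimage by [f] of some Borel set [B k]; as the target is a space of
    sequences of Booleans, these sets assemble directly into [g]. *)
Lemma exact_factor d (T : measurableType d) (f h : T -> borel_cantor) :
  exactly_measurable f -> measurable_fun setT h ->
  exists2 g : borel_cantor -> borel_cantor, measurable_fun setT g & h = g \o f.
Proof.
move=> fE mh.
have /choice[B BP] : forall k, exists B : set borel_cantor,
    measurable B /\ f @^-1` B = [set x | h x k].
  move=> k; have : measurable [set x | h x k].
    rewrite -[X in measurable X]setTI.
    by apply: (mh measurableT [set y | y k]); exact: measurable_coord.
  by rewrite -fE => -[B mB]; rewrite setTI; exists B.
exists (fun y k => `[< B k y >]).
  apply: measurable_cantorP => k; rewrite (_ : [set _ | _] = B k); first by case: (BP k).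
  by apply/seteqP; split => y /= /asboolP.
apply/funext => x; apply/funext => k /=; case: (BP k) => _ /seteqP[Bh hB].
by apply/idP/asboolP => [/hB//|/Bh].
Qed.

Lemma exactly_measurableP d (T : measurableType d) (f : T -> borel_cantor)
    (E : set T) : exactly_measurable f ->
  measurable E <-> exists2 B : set borel_cantor, measurable B & f @^-1` B = E.
Proof.
move=> fE; rewrite -fE; split => -[B mB BE]; exists B => //.
  by rewrite -BE setTI.
by rewrite setTI.
Qed.

Lemma exactly_measurable_fun d (T : measurableType d) (f : T -> borel_cantor) :
  exactly_measurable f -> measurable_fun setT f.
Proof. by move=> fE _ B mB; rewrite setTI; apply/(exactly_measurableP _ fE); exists B. Qed.

(** The coordinate half spaces generate the Borel sets. *)
Lemma exactly_measurable_countably_generated d (T : measurableType d)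
    (f : T -> borel_cantor) : exactly_measurable f -> countably_generated T.
Proof.
move=> fE; pose S := range (fun k => [set x : T | f x k]).
have mS : S `<=` measurable.
  move=> _ [k _ <-]; apply/(exactly_measurableP _ fE).
  by exists [set y | y k] => //; exact: measurable_coord.
exists S; split => //; first exact: card_image_le.
apply/seteqP; split; last exact: smallest_sub (sigma_algebra_measurable _) mS.
move=> E /(exactly_measurableP _ fE)[B mB <-].
have mf : measurable_fun setT (f : g_sigma_algebraType S -> borel_cantor).
  by apply: measurable_cantorP => k; apply: sub_sigma_algebra; exists k.
by rewrite -[_ @^-1` _]setTI; exact: mf.
Qed.

(** Points are Borel and measurable sets are unions of fibres. *)
Lemma exactly_measurable_atom d (T : measurableType d) (f : T -> borel_cantor)
    (x : T) : exactly_measurable f -> atom_of x = [set z | f z = f x].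
Proof.
move=> fE; apply/seteqP; split => [z zx|z fzx E [/(exactly_measurableP _ fE)[B _ <-]]].
  apply: (zx [set z | f z = f x]); split => //.
  by apply: measurable_equalizer; [exact: exactly_measurable_fun|exact: measurable_cst].
by rewrite /= fzx.
Qed.

(** * Projective systems of measurable spaces *)

Section projective_system.
Context (dn : nat -> measure_display) (Xn : forall n, measurableType (dn n))
  (i : forall n, Xn n.+1 -> Xn n) (d : measure_display) (X : measurableType d)
  (tau : forall n, X -> Xn n).
Arguments i : clear implicits.
Arguments tau : clear implicits.
Hypothesis hi : forall n, measurable_fun setT (i n).
Hypothesis htau : forall n, measurable_fun setT (tau n).
Hypothesis htau_surj : forall n, set_surj setT setT (tau n).
Hypothesis hitau : forall n, i n \o tau n.+1 = tau n.
Hypothesis hgen : d.-measurable =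
  <<s \bigcup_n preimage_set_system setT (tau n) (dn n).-measurable >>.
Hypothesis hatoms : forall A : forall n, set (Xn n),
  (forall n, is_atom (A n)) -> (forall n, A n.+1 `<=` i n @^-1` A n) ->
  exists x : X, forall n, A n (tau n x).

Lemma tauS n x : tau n x = i n (tau n.+1 x).
Proof. by rewrite -hitau. Qed.

Lemma tau_eq_le m n x y : m <= n -> tau n x = tau n y -> tau m x = tau m y.
Proof.
elim: n => [|n IH]; rewrite leq_eqVlt => /orP[/eqP<-|]; rewrite ?ltn0// ltnS.
by move=> mn txy; apply: IH => //; rewrite (tauS _ x) (tauS _ y) txy.
Qed.

Lemma tau_section : exists s : forall n, Xn n -> X, forall n z, tau n (s n z) = z.
Proof.
have ex n z : exists x, tau n x = z.
  by have [x _ <-] := @htau_surj n z I; exists x.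
by exists (fun n z => projT1 (cid (ex n z))) => n z; case: cid.
Qed.

Definition tau_inv n : Xn n -> X := projT1 (cid tau_section) n.

Lemma tau_invK n : cancel (@tau_inv n) (tau n).
Proof. by move=> z; rewrite /tau_inv; case: cid. Qed.

(** The composite of [i m], ..., [i n.-1], written without dependent casts: go up
    to [X] by any section of [tau n] and down by [tau m].  It is meaningful for
    [m <= n] only. *)
Definition proj_le m n (z : Xn n) : Xn m := tau m (tau_inv z).

Lemma proj_le_tau m n x : m <= n -> proj_le m (tau n x) = tau m x.
Proof. by move=> mn; apply: (tau_eq_le mn); rewrite tau_invK. Qed.

Lemma proj_leS m n z : m <= n -> proj_le m z = proj_le m (i n z).
Proof. by move=> mn; apply: (tau_eq_le mn); rewrite tauS !tau_invK. Qed.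

Lemma measurable_proj_le m n : m <= n -> measurable_fun setT (@proj_le m n).
Proof.
have mm k : measurable_fun setT (@proj_le k k).
  rewrite (_ : @proj_le k k = id); first exact: measurable_id.
  by apply/funext => z; rewrite /proj_le tau_invK.
elim: n => [|n IH]; rewrite leq_eqVlt => /orP[/eqP<-|]; rewrite ?ltn0//.
rewrite ltnS => mn; rewrite (_ : @proj_le m n.+1 = @proj_le m n \o i n).
  exact: measurableT_comp (IH mn) (@hi n).
by apply/funext => z; rewrite /= proj_leS.
Qed.

Context (f : forall n, Xn n -> borel_cantor).
Arguments f : clear implicits.
Hypothesis fE : forall n, exactly_measurable (f n).
Hypothesis fA : forall n, analytic (range (f n)).

Definition code (x : X) : borel_cantor := join_blocks (fun n => f n (tau n x)).

Lemma block_code n x : block n (code x) = f n (tau n x).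
Proof. by rewrite /code block_join. Qed.

Lemma measurable_code : measurable_fun setT code.
Proof.
apply: measurable_cantorP => k.
have mf : measurable_fun setT (f (unpair_nat k).1 \o tau (unpair_nat k).1).
  by apply: measurableT_comp; [exact: exactly_measurable_fun|exact: htau].
have := mf measurableT _ (measurable_coord (unpair_nat k).2).
by rewrite setTI.
Qed.

Lemma code_exact : exactly_measurable code.
Proof.
apply/seteqP; split=> [_ [B mB <-]|]; first exact: measurable_code.
rewrite hgen; apply: smallest_sub.
  by apply: sigma_algebra_preimage; exact: sigma_algebra_measurable.
move=> _ [n _ [A mA <-]].
have /(exactly_measurableP _ (@fE n))[B mB <-] := mA.
exists (@block bool n @^-1` B).
  by rewrite -[_ @^-1` _]setTI; exact: (measurable_block n).
by rewrite !setTI; apply/seteqP; split => x /=; rewrite block_code.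
Qed.

Lemma factor_exists : exists g : nat -> borel_cantor -> borel_cantor,
  forall n, measurable_fun setT (g n) /\ forall z : Xn n.+1, f n (i n z) = g n (f n.+1 z).
Proof.
suff /choice[g gP] : forall n, exists g : borel_cantor -> borel_cantor,
    measurable_fun setT g /\ forall z : Xn n.+1, f n (i n z) = g (f n.+1 z).
  by exists g.
move=> n; have [] := @exact_factor _ (Xn n.+1) (f n.+1) (f n \o i n) (fE n.+1).
  by apply: measurableT_comp; [exact: exactly_measurable_fun|exact: hi].
by move=> g mg gE; exists g; split => // z; have /(congr1 (fun h => h z)) := gE.
Qed.

(** The map [i n], read through [f n.+1] and [f n]. *)
Definition transition : nat -> borel_cantor -> borel_cantor := projT1 (cid factor_exists).

Lemma measurable_transition n : measurable_fun setT (transition n).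
Proof. by rewrite /transition; case: cid => g /= /(_ n)[]. Qed.

Lemma transitionE n (z : Xn n.+1) : transition n (f n.+1 z) = f n (i n z).
Proof. by rewrite /transition; case: cid => g /= /(_ n)[]. Qed.

Definition coherent n : set borel_cantor :=
  [set y | transition n (block n.+1 y) = block n y].

Lemma measurable_coherent n : measurable (coherent n).
Proof.
apply: measurable_equalizer; last exact: measurable_block.
exact: measurableT_comp (measurable_transition n) (measurable_block n.+1).
Qed.

(** For [y] in the right-hand side the fibres of the maps [f n] over the blocks of
    [y] are atoms, and coherence says that each is mapped into the preceding
    one. *)
Lemma range_code : range code =
  \bigcap_n (@block bool n @^-1` range (f n) `&` coherent n).
Proof.
apply/seteqP; split => [_ [x _ <-] n _|y yP].
  split; first by rewrite /= block_code; exists (tau n x).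
  by rewrite /coherent /= !block_code transitionE -tauS.
have zP n : exists z : Xn n, f n z = block n y.
  by have [[z _ <-] _] := yP n I; exists z.
pose A n := [set z : Xn n | f n z = block n y].
have [x xP] : exists x, forall n, A n (tau n x).
  apply: hatoms => n.
    have [z zy] := zP n; exists z.
    by rewrite (exactly_measurable_atom _ (@fE n)) zy.
  move=> z /= zy; rewrite /A /= -transitionE zy.
  by case: (yP n I).
exists x => //; apply: block_inj => n; rewrite block_code; exact: xP.
Qed.

Lemma analytic_range_code : analytic (range code).
Proof.
apply/analytic_closed_image; rewrite range_code.
apply: closed_image_bigcap => n; apply: closed_imageI.
  apply: closed_image_preimage; first exact: continuous_block.
  exact/analytic_closed_image.
by apply: closed_image_borel; exact: measurable_coherent.
Qed.

Context (R : realType) (mun : forall n, probability (Xn n) R).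
Hypothesis hcons : forall n (B : set (Xn n)), measurable B ->
  mun n.+1 (i n @^-1` B) = mun n B.

Lemma mun_proj_le m n (B : set (Xn m)) : m <= n -> measurable B ->
  mun n (@proj_le m n @^-1` B) = mun m B.
Proof.
move=> mn mB; elim: n mn => [|n IH]; rewrite leq_eqVlt => /orP[/eqP<-|]; rewrite ?ltn0//.
- by apply: (congr1 (mun m)); apply/seteqP; split => z; rewrite /= /proj_le tau_invK.
- by apply: (congr1 (mun m)); apply/seteqP; split => z; rewrite /= /proj_le tau_invK.
rewrite ltnS => mn; rewrite -IH// -[RHS]hcons.
  by apply: (congr1 (mun n.+1)); apply/seteqP; split => z; rewrite /= proj_leS.
by rewrite -[_ @^-1` _]setTI; exact: measurable_proj_le.
Qed.

(** The part of [code] visible at level [n]; the truncation removes the values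
    that depend on the choice of the section. *)
Definition level_code n (z : Xn n) : borel_cantor := trunc n (code (tau_inv z)).

Lemma level_codeE m n (z : Xn n) : m <= n ->
  trunc m (level_code z) = level_code (proj_le m z).
Proof.
move=> mn; rewrite /level_code trunc_trunc//; apply/funext => k.
rewrite /trunc; case: ifP => // km; rewrite /code /join_blocks; congr (f _ _ _).
by apply: (tau_eq_le km); rewrite tau_invK.
Qed.

Lemma block_level_code m n (z : Xn n) : m <= n ->
  block m (level_code z) = f m (proj_le m z).
Proof. by move=> mn; rewrite /level_code block_trunc// block_code. Qed.

Lemma measurable_level_code n : measurable_fun setT (@level_code n).
Proof.
apply: measurable_cantorP => k; rewrite /level_code /trunc.
have [kn|_] := leqP (unpair_nat k).1 n; last first.
  by rewrite (_ : [set _ | _] = set0)//; apply/seteqP; split.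
have mf : measurable_fun setT (f (unpair_nat k).1 \o @proj_le (unpair_nat k).1 n).
  apply: measurableT_comp; first exact: exactly_measurable_fun.
  exact: measurable_proj_le.
have := mf measurableT _ (measurable_coord (unpair_nat k).2).
by rewrite setTI.
Qed.

Definition limit_law (P : probability borel_cantor R) :=
  forall n (B : set borel_cantor), measurable B ->
    P (trunc n @^-1` B) = mun n (@level_code n @^-1` B).

Lemma limit_law_exists : exists P : probability borel_cantor R, limit_law P.
Proof.
have /choice[nu nuE] : forall n, exists Q : probability borel_cantor R,
    forall B, Q B = mun n (@level_code n @^-1` B).
  by move=> n; apply: exists_law; exact: measurable_level_code.
have [|P PE] := @kolmogorov_extension R nu.
  move=> m n B mn mB; rewrite !nuE -(mun_proj_le mn); last first.
    by rewrite -[_ @^-1` _]setTI; exact: measurable_level_code.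
  by apply: (congr1 (mun n)); apply/seteqP; split => z; rewrite /= level_codeE.
by exists P => n B mB; rewrite PE// nuE.
Qed.

Lemma law_block (P : probability borel_cantor R) n (B : set borel_cantor) :
  limit_law P ->
  measurable B -> P (@block bool n @^-1` B) = mun n (f n @^-1` B).
Proof.
move=> PE mB; have := PE n (@block bool n @^-1` B).
rewrite -[X in measurable X]setTI => /(_ (measurable_block n measurableT mB)).
have -> : trunc n @^-1` (@block bool n @^-1` B) = @block bool n @^-1` B.
  by apply/seteqP; split => y; rewrite /= block_trunc.
move=> ->; apply: (congr1 (mun n)); apply/seteqP; split => z;
by rewrite /= block_level_code// /proj_le tau_invK.
Qed.

(** Coherence at [n] concerns the blocks up to [n.+1] only, and there it holds
    everywhere on [Xn n.+1]. *)
Lemma law_coherent (P : probability borel_cantor R) n :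
  limit_law P ->
  P (coherent n) = 1%E.
Proof.
move=> PE; have := PE n.+1 (coherent n) (measurable_coherent n).
have -> : trunc n.+1 @^-1` (coherent n) = coherent n.
  by apply/seteqP; split => y; rewrite /coherent /= !block_trunc.
move=> ->; rewrite (_ : _ @^-1` _ = setT) ?probability_setT//.
apply/seteqP; split => // z _; rewrite /coherent /= !block_level_code//.
by rewrite transitionE /proj_le -tauS.
Qed.

(** [P] is concentrated on a Borel set [S] contained in the range of [code], and
    is transported to [X] by a section of [code] over [S]. *)
Lemma limit_measure_exists : exists mu : probability X R,
  forall n (B : set (Xn n)), measurable B -> mu (tau n @^-1` B) = mun n B.
Proof.
have [P PE] := limit_law_exists.
have /choice[K KP] : forall n, exists K : set borel_cantor,
    [/\ measurable K, K `<=` range (f n) & P (@block bool n @^-1` K) = 1%E].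
  move=> n; have [Q QE] := exists_law (mun n) (exactly_measurable_fun (@fE n)).
  have [|K [mK KR QK]] := @analytic_conull_core R Q _ (@fA n).
    move=> B mB RB; rewrite QE (_ : _ @^-1` _ = setT) ?probability_setT//.
    by apply/seteqP; split => // z _; apply: RB; exists z.
  by exists K; split => //; rewrite (law_block _ PE)// -QE.
have mblock n (B : set borel_cantor) :
    measurable B -> measurable (@block bool n @^-1` B : set borel_cantor).
  by move=> mB; rewrite -[_ @^-1` _]setTI; exact: measurable_block.
pose S : set borel_cantor :=
  \bigcap_n (@block bool n @^-1` K n `&` coherent n).
have mSn n : measurable (@block bool n @^-1` K n `&` coherent n : set borel_cantor).
  apply: measurableI; last exact: measurable_coherent.
  by apply: mblock; case: (KP n).
have mS : measurable S by exact: bigcapT_measurable.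
have PS : P S = 1%E.
  apply: probability_bigcap1 => // n; case: (KP n) => mK _ PK.
  rewrite -PK; apply: (probability_eq_on (measurable_coherent n)) => //.
  - exact: law_coherent.
  - exact: mblock.
  - by rewrite -setIA setIid.
have SF : S `<=` range code.
  rewrite range_code => y yS n _; have [yK yC] := yS n I; split => //.
  by case: (KP n) => _ + _; apply.
pose r (y : borel_cantor) : X := xget point [set x | S y /\ code x = y].
have rS y : S y -> code (r y) = y.
  move=> Sy; have [x _ xy] := SF y Sy.
  have Ex : [set x | S y /\ code x = y] x by [].
  by have [] : [set x | S y /\ code x = y] (r y) by exact: xgetI Ex.
have rN y : ~ S y -> r y = point.
  by move=> nSy; apply: xgetPN => x [].
(* A measurable set of [X] is [code @^-1` B], and [code \o r] is the identity on
   [S] and constant outside. *)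
have mr : measurable_fun setT r.
  move=> _ E /(exactly_measurableP _ code_exact)[B mB <-]; rewrite setTI.
  rewrite (_ : _ @^-1` _ = (S `&` B) `|` (~` S `&` [set _ | B (code point)])).
    apply: measurableU; apply: measurableI => //; first exact: measurableC.
    have [Bp|nBp] := pselect (B (code point)).
      by rewrite (_ : [set _ | _] = setT)//; apply/seteqP; split.
    by rewrite (_ : [set _ | _] = set0)//; apply/seteqP; split.
  apply/seteqP; split => y /=.
    have [Sy|nSy] := pselect (S y); first by rewrite rS//; left.
    by rewrite rN//; right.
  by move=> [[Sy By]|[nSy Bp]]; [rewrite rS|rewrite rN].
have [mu muE] := exists_law P mr.
exists mu => n E /(exactly_measurableP _ (@fE n))[B mB <-].
rewrite muE -(law_block _ PE)//.
apply: (probability_eq_on mS PS).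
- rewrite -[_ @^-1` _]setTI; apply: mr => //.
  by rewrite -[_ @^-1` _]setTI; apply: htau => //; apply/(exactly_measurableP _ (fE n)); exists B.
- exact: mblock.
by apply/seteqP; split => y [/= + Sy]; rewrite -block_code rS.
Qed.

(** Two sets [tau m @^-1` A] and [tau n @^-1` B] are both pulled back from the
    level [maxn m n], hence so is their intersection. *)
Lemma limit_measure_unique (mu nu : probability X R) :
  (forall n (B : set (Xn n)), measurable B -> mu (tau n @^-1` B) = nu (tau n @^-1` B)) ->
  forall E, measurable E -> mu E = nu E.
Proof.
move=> munu E mE.
apply: (@measure_unique _ R X _ (fun=> setT) hgen _ _ _ mu nu) => //.
- move=> _ _ [m _ [A mA <-]] [n _ [B mB <-]].
  pose N := maxn m n; exists N => //.
  exists (@proj_le m N @^-1` A `&` @proj_le n N @^-1` B).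
    by apply: measurableI; rewrite -[_ @^-1` _]setTI;
      apply: measurable_proj_le => //; rewrite ?leq_maxl ?leq_maxr.
  rewrite !setTI; apply/seteqP; split => x;
  by rewrite /= !proj_le_tau ?leq_maxl ?leq_maxr.
- by move=> _; exists 0 => //; exists setT => //; rewrite setTI.
- by rewrite bigcup_const.
- by move=> _ [n _ [A mA <-]]; rewrite setTI; exact: munu.
- by move=> _; rewrite [X in (X < _)%E](probability_setT mu) ltry.
Qed.

End projective_system.

Theorem theorem10p1 (R : realType)
  (dn : nat -> measure_display) (Xn : forall n : nat, measurableType (dn n))
  (i : forall n : nat, Xn n.+1 -> Xn n)
  (d : measure_display) (X : measurableType d)
  (tau : forall n : nat, X -> Xn n)
  (hcg : forall n : nat, countably_generated (Xn n))
  (hi : forall n : nat, measurable_fun [set: Xn n.+1] (i n))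
  (htau : forall n : nat, measurable_fun [set: X] (tau n))
  (htau_surj : forall n : nat, set_surj [set: X] [set: Xn n] (tau n))
  (hitau : forall n : nat, i n \o tau n.+1 = tau n)
  (hgen : d.-measurable =
     <<s \bigcup_n preimage_set_system [set: X] (tau n) (dn n).-measurable >>)
  (hatoms : forall A : forall n : nat, set (Xn n),
     (forall n : nat, is_atom (A n)) ->
     (forall n : nat, A n.+1 `<=` i n @^-1` A n) ->
     exists x : X, forall n : nat, A n (tau n x))
  (hA : forall n : nat, type_A (Xn n))
  (mun : forall n : nat, probability (Xn n) R)
  (hcons : forall (n : nat) (B : set (Xn n)), measurable B ->
     pushforward (mun n.+1) (i n) B = mun n B) :
  type_A X /\
  exists mu : probability X R,
    (forall (n : nat) (B : set (Xn n)), measurable B ->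
       pushforward mu (tau n) B = mun n B) /\
    (forall nu : probability X R,
       (forall (n : nat) (B : set (Xn n)), measurable B ->
          pushforward nu (tau n) B = mun n B) ->
       forall E : set X, measurable E -> nu E = mu E).
Proof.
pose f n : Xn n -> borel_cantor := s2val (cid2 (hA n).2).
have fE n : exactly_measurable (f n) := s2valP (cid2 (hA n).2).
have fA n : analytic (range (f n)) := s2valP' (cid2 (hA n).2).
split.
  have cE := code_exact htau hgen fE.
  split; first exact: exactly_measurable_countably_generated cE.
  exists (code tau f) => //.
  exact: (analytic_range_code hi hitau hatoms fE fA).
have [mu muE] := limit_measure_exists hi htau htau_surj hitau hgen hatoms fE fA
  hcons.
exists mu; split => // nu nuE.
apply: (limit_measure_unique hi htau_surj hitau hgen) => n B mB.
by rewrite muE// -nuE.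
Qed.
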